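(* There is a chore instance with five agents and twelve chores in which every cost function is additive and strictly positive (every chore has strictly positive cost for every agent), which admits no exact PMMS allocation, and whose optimal PMMS factor $\rho^\star(I)$ is exactly $R:=\frac{220413}{200000}=1.102065$. Consequently, $\rho^{\star}_{\mathrm{PMMS}}\ge R>1$.
   Context: An additive-chore instance consists of a finite set $N=[n]$ of agents, a finite set $M$ of indivisible chores, and for each agent $i$ an additive cost function $c_i:2^M\to\mathbb{R}_{\ge0}$. An allocation $X=(X_i)_{i\in N}$ is a partition of $M$ into $n$ (possibly empty) bundles. For $S\subseteq M$, $\mu^{\mathrm C}_i(2,S)=\min_{(P_1,P_2)\in\Pi_2(S)}\max\{c_i(P_1),c_i(P_2)\}$, where $\Pi_2(S)$ is the set of ordered bipartitions of $S$ (parts may be empty). An allocation $X$ is $\rho$-PMMS if $c_i(X_i)\le\rho\,\mu^{\mathrm C}_i(2,X_i\cup X_j)$ for all $i\ne j$, and exact PMMS if it is $1$-PMMS. The PMMS factor of an allocation is $\rho(X)=\max\{c_i(X_i)/\mu^{\mathrm C}_i(2,X_i\cup X_j): i\neq j,\ \mu^{\mathrm C}_i(2,X_i\cup X_j)>0\}$ (with the maximum over an empty set taken to be $0$); the optimal PMMS factor (ratio) of an instance $I$ is $\rho^\star(I)=\min_X\rho(X)$ over all allocations; and $\rho^{\star}_{\mathrm{PMMS}}=\sup_I\rho^\star(I)$ over all additive-chore instances $I$. *)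

(* Defs.v *)
From HB Require Import structures.
From mathcomp Require Import all_boot all_order all_algebra.
From mathcomp Require Import all_classical all_reals.
From mathcomp Require Import ereal.
From mathcomp Require Import finset.

Set Implicit Arguments.
Unset Strict Implicit.
Unset Printing Implicit Defensive.

Import Order.TTheory GRing.Theory Num.Theory.

Local Open Scope ring_scope.

Record chore_instance (R : realType) := ChoreInstance {
  nagents : nat;
  nagents_gt0 : (0 < nagents)%N;
  chore : finType;
  cost : 'I_nagents -> {set chore} -> R;
  cost_additive : forall (i : 'I_nagents) (S : {set chore}),
    cost i S = \sum_(g in S) cost i [set g];
  cost_ge0 : forall (i : 'I_nagents) (S : {set chore}), 0 <= cost i S
}.

Definition assignment (R : realType) (I : chore_instance R) : finType :=
  {ffun 'I_(nagents I) -> {set chore I}}.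

Definition is_allocation (R : realType) (I : chore_instance R)
    (X : assignment I) : bool :=
  [forall i, forall j, (i != j) ==> [disjoint X i & X j]]
    && (\bigcup_(i : 'I_(nagents I)) X i == [set: chore I]).

Definition is_bipartition (T : finType) (S : {set T}) (P : {set T} * {set T}) :
    bool :=
  (P.1 :|: P.2 == S) && [disjoint P.1 & P.2].

(* The initial value [cost i S] of the iterated minimum is the value
   max(c_i(S), c_i(set0)) of the bipartition (S, set0), so this is the genuine
   minimum over the bipartitions of S; see [mms2_attained] and [mms2_le]. *)
Definition mms2 (R : realType) (I : chore_instance R) (i : 'I_(nagents I))
    (S : {set chore I}) : R :=
  \big[Num.min/cost i S]_(P : {set chore I} * {set chore I}
                          | is_bipartition S P)
     Num.max (cost i P.1) (cost i P.2).

Definition is_PMMS (R : realType) (I : chore_instance R) (rho : R)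
    (X : assignment I) : Prop :=
  forall i j : 'I_(nagents I), i != j ->
    cost i (X i) <= rho * mms2 i (X i :|: X j).

Definition is_exact_PMMS (R : realType) (I : chore_instance R)
    (X : assignment I) : Prop :=
  is_PMMS 1 X.

(* The ratios are nonnegative, so the initial value 0 of the iterated maximum
   only matters when there is no admissible pair of agents. *)
Definition pmms_factor (R : realType) (I : chore_instance R)
    (X : assignment I) : R :=
  \big[Num.max/0]_(p : 'I_(nagents I) * 'I_(nagents I)
                   | (p.1 != p.2) && (0 < mms2 p.1 (X p.1 :|: X p.2)))
     (cost p.1 (X p.1) / mms2 p.1 (X p.1 :|: X p.2)).

Definition all_to_first (R : realType) (I : chore_instance R) : assignment I :=
  [ffun i => if i == Ordinal (nagents_gt0 I) then [set: chore I] else set0].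

(* The initial value of the iterated minimum is the factor of an actual
   allocation ([all_to_first_allocation]), so this is the genuine minimum over
   all allocations; see [optimal_pmms_attained] and [optimal_pmms_le]. *)
Definition optimal_pmms_factor (R : realType) (I : chore_instance R) : R :=
  \big[Num.min/pmms_factor (all_to_first I)]_(X : assignment I
                                              | is_allocation X)
     pmms_factor X.

Definition pmms_sup (R : realType) : \bar R :=
  ereal_sup [set x : \bar R | exists I : chore_instance R,
                                x = (optimal_pmms_factor I)%:E]%classic.

(* 220413 / 200000 = 1.102065, written with small literals because numerals
   are parsed through unary natural numbers. *)
Definition pmms_bound (R : realType) : R :=
  (220 * 10 ^+ 3 + 413) / (2 * 10 ^+ 5).

Section Sanity.
Variables (R : realType) (I : chore_instance R).

Lemma cost_set0 (i : 'I_(nagents I)) : cost i set0 = 0.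
Proof. by rewrite cost_additive big_set0. Qed.

Lemma bipartition_trivial (T : finType) (S : {set T}) :
  is_bipartition S (S, set0).
Proof. by rewrite /is_bipartition /= setU0 eqxx -setI_eq0 setI0 eqxx. Qed.

Lemma mms2_attained (i : 'I_(nagents I)) (S : {set chore I}) :
  exists2 P, is_bipartition S P & mms2 i S = Num.max (cost i P.1) (cost i P.2).
Proof.
rewrite /mms2; elim/big_ind: _ => [|x y [P bP ->] [Q bQ ->]|P bP].
- exists (S, set0); first exact: bipartition_trivial.
  by rewrite /= cost_set0 max_l ?cost_ge0.
- by case: (leP (Num.max (cost i P.1) _)) => _; [exists P | exists Q].
- by exists P.
Qed.

Lemma mms2_le (i : 'I_(nagents I)) (S : {set chore I}) P :
  is_bipartition S P -> mms2 i S <= Num.max (cost i P.1) (cost i P.2).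
Proof. exact: bigmin_le_cond. Qed.

Lemma all_to_first_allocation : is_allocation (all_to_first I).
Proof.
apply/andP; split.
  apply/forallP => i; apply/forallP => j; apply/implyP => neq_ij.
  rewrite !ffunE; case: (eqVneq i) => [<-|_].
    by rewrite eq_sym (negPf neq_ij) -setI_eq0 setI0.
  by rewrite -setI_eq0 set0I.
apply/eqP/setP => g; rewrite in_setT.
apply/bigcupP; exists (Ordinal (nagents_gt0 I)) => //.
by rewrite ffunE eqxx.
Qed.

Lemma optimal_pmms_attained :
  exists2 X : assignment I, is_allocation X &
    optimal_pmms_factor I = pmms_factor X.
Proof.
rewrite /optimal_pmms_factor.
elim/big_ind: _ => [|x y [X aX ->] [Y aY ->]|X aX].
- by exists (all_to_first I); first exact: all_to_first_allocation.
- by case: (leP (pmms_factor X)) => _; [exists X | exists Y].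
- by exists X.
Qed.

Lemma optimal_pmms_le (X : assignment I) :
  is_allocation X -> optimal_pmms_factor I <= pmms_factor X.
Proof. exact: bigmin_le_cond. Qed.

Lemma pmms_factor_ge0 (X : assignment I) : 0 <= pmms_factor X.
Proof. exact: bigmax_ge_id. Qed.

End Sanity.

(* Main.v *)
(* The twelve chores come in three kinds of four identical copies. Three agents
   price the kinds at (157283, 100000, 20413), the other two at (4, 1, 6), so
   bundles matter only through their kind counts and so do the values mu(2, S).
   The ratio R is the price of the bundle (0, 2, 1) over 200000, for an agent of
   the first group facing (0, 1, 0), for whom the best split of the union is
   (0, 2, 0) against (0, 1, 1). The price 157283 is the only integer that keeps
   both (1, 0, 1) against (0, 1, 2) and (0, 2, 2) against (1, 0, 1) at ratio at
   least R. An exhaustive search over the count vectors of five bundles, cut as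
   soon as two agents are in a pair of ratio at least R, shows that every
   allocation contains such a pair; and one allocation has no worse pair. *)

From Stdlib Require Import NArith Lia.
From HB Require Import structures.
Require Import Defs.
From mathcomp Require Import all_boot all_order all_algebra.
From mathcomp Require Import all_classical all_reals.
From mathcomp Require Import ereal.
From mathcomp Require Import finset.
Import Order.TTheory GRing.Theory Num.Theory.
Local Open Scope ring_scope.

(* Locked, so that unification never unfolds large values to unary naturals. *)
HB.lock Definition binR (R : realType) (n : N) : R := (N.to_nat n)%:R.

(** * Binary numbers embedded in the real field *)

Section BinaryNat.
Variable R : realType.

Local Notation binR := (binR R).

Lemma binR_ge0 n : 0 <= binR n.
Proof. by rewrite binR.unlock ler0n. Qed.

Lemma binRD m n : binR (m + n)%num = binR m + binR n.
Proof. by rewrite !binR.unlock N2Nat.inj_add plusE natrD. Qed.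

Lemma binRM m n : binR (m * n)%num = binR m * binR n.
Proof. by rewrite !binR.unlock N2Nat.inj_mul multE natrM. Qed.

Lemma binR_of_nat n : binR (N.of_nat n) = n%:R.
Proof. by rewrite !binR.unlock Nat2N.id. Qed.

Lemma binR_le m n : (m <= n)%num -> binR m <= binR n.
Proof. by move=> le_mn; rewrite -(N.sub_add _ _ le_mn) binRD lerDr binR_ge0. Qed.

Lemma binR_gt0 n : n <> 0%num -> 0 < binR n.
Proof.
move=> n0; have /binR_le : (1 <= n)%num by lia.
by rewrite {1}binR.unlock; apply: lt_le_trans ltr01.
Qed.

Lemma binR_max m n : binR (N.max m n) = Num.max (binR m) (binR n).
Proof.
case: (N.le_ge_cases m n) => [le_mn|le_nm].
  by rewrite N.max_r // max_r // binR_le.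
by rewrite N.max_l // max_l // binR_le.
Qed.

End BinaryNat.

(** * Count vectors, their prices and their two-part shares *)

Definition counts : eqType := (nat * nat * nat)%type.
Definition weights : Type := (N * N * N)%type.

Definition component (T : Type) (v : T * T * T) (t : 'I_3) : T :=
  nth v.1.1 [:: v.1.1; v.1.2; v.2] t.

Arguments component {T} v t.

Definition add_counts (u v : counts) : counts :=
  (u.1.1 + v.1.1, u.1.2 + v.1.2, u.2 + v.2)%N.
Definition sub_counts (u v : counts) : counts :=
  (u.1.1 - v.1.1, u.1.2 - v.1.2, u.2 - v.2)%N.
Definition below (v : counts) : seq counts :=
  [seq (x, z) | x <- [seq (x, y) | x <- iota 0 v.1.1.+1, y <- iota 0 v.1.2.+1],
                z <- iota 0 v.2.+1].

Lemma countsP (T : Type) (u v : T * T * T) :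
  (forall t, component u t = component v t) -> u = v.
Proof.
case: u v => [[a b] c] [[a' b'] c'] eq_uv.
have := eq_uv (@Ordinal 3 0 isT); have := eq_uv (@Ordinal 3 1 isT).
by have := eq_uv (@Ordinal 3 2 isT); rewrite /component /= => -> -> ->.
Qed.

Lemma component_add u v t :
  component (add_counts u v) t = (component u t + component v t)%N.
Proof. by case: t => [[|[|[|//]]] ?]. Qed.

Lemma mem_below (u v : counts) :
  (u \in below v) = [forall t, component u t <= component v t]%N.
Proof.
case: u v => [[a b] c] [[a' b'] c'].
apply/idP/forallP => [|le_uv].
  case/allpairsPdep=> p [z [/allpairsPdep[x [y []]]]].
  rewrite !mem_iota /= !add0n !ltnS => lex ley -> lez [-> -> ->].
  by case=> [[|[|[|//]]] ?].
have := le_uv (@Ordinal 3 0 isT); have := le_uv (@Ordinal 3 1 isT).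
have := le_uv (@Ordinal 3 2 isT); rewrite /component /= => lec leb lea.
apply/allpairsPdep; exists (a, b), c; split=> //; last by rewrite mem_iota ltnS.
by apply/allpairsPdep; exists a, b; split=> //; rewrite mem_iota ltnS.
Qed.

Lemma add_countsK u v : sub_counts (add_counts u v) u = v.
Proof. by case: u v => [[a b] c] [[a' b'] c']; rewrite /sub_counts /= !addKn. Qed.

Lemma sub_countsK u v : u \in below v -> add_counts u (sub_counts v u) = v.
Proof.
rewrite mem_below => /forallP le_uv; case: u v le_uv => [[a b] c] [[a' b'] c'] le_uv.
have := le_uv (@Ordinal 3 0 isT); have := le_uv (@Ordinal 3 1 isT).
have := le_uv (@Ordinal 3 2 isT); rewrite /component /= => lec leb lea.
by rewrite /add_counts /= !subnKC.
Qed.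

Definition price (w : weights) (v : counts) : N :=
  (w.1.1 * N.of_nat v.1.1 + w.1.2 * N.of_nat v.1.2 + w.2 * N.of_nat v.2)%num.
Definition split_price (w : weights) (v u : counts) : N :=
  N.max (price w u) (price w (sub_counts v u)).
(** The value mu(2, S) of a set S with counts [v], as [mms2E] shows. The initial value is the price
    of the split [u = v], which leaves the other side empty, so the fold is a genuine minimum over
    splits. *)
Definition share (w : weights) (v : counts) : N :=
  foldr (fun u m => N.min (split_price w v u) m) (price w v) (below v).

Lemma share_le w v u : u \in below v -> (share w v <= split_price w v u)%num.
Proof.
rewrite /share; elim: (below v) => //= x s IHs; rewrite inE => /orP[/eqP->|/IHs le_s].
  exact: N.le_min_l.
exact: N.le_trans (N.le_min_r _ _) le_s.
Qed.

Lemma share_attained w v :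
  exists2 u, u \in below v & share w v = split_price w v u.
Proof.
have: exists2 u, u \in below v & price w v = split_price w v u.
  exists v; first by rewrite mem_below; apply/forallP.
  rewrite /split_price N.max_l // (_ : sub_counts v v = (0, 0, 0)%N).
    by rewrite /price /=; lia.
  by rewrite /sub_counts !subnn.
rewrite /share; move: (price w v) => p ex_p.
(* This trivial inclusion separates the list being folded, which shrinks in the induction, from the
   fixed list in which [u] must lie. *)
have: {subset below v <= below v} by [].
elim: {1 4}(below v) => //= x s IHs sub_s.
have [|u uv ->] := IHs; first by move=> y ys; apply: sub_s; rewrite inE ys orbT.
case: (N.min_spec (split_price w v x) (split_price w v u)) => -[_ ->]; last by exists u.
by exists x => //; apply: sub_s; rewrite mem_head.
Qed.

(** * Exhaustive search over the agents' bundles *)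

Definition total (f : nat -> counts) (s : seq nat) : counts :=
  foldr (fun i v => add_counts (f i) v) (0, 0, 0)%N s.

(* [if] rather than [||], both of whose arguments vm_compute would evaluate. *)
Fixpoint search (bad : rel (nat * counts)) (agents : seq nat)
    (placed : seq (nat * counts)) (left_over : counts) : bool :=
  if agents is i :: agents' then
    all (fun u => if has (bad (i, u)) placed then true
                  else search bad agents' ((i, u) :: placed)
                         (sub_counts left_over u))
        (if agents' is [::] then [:: left_over] else below left_over)
  else false.

(** Follow the branch that gives each agent [i] its actual bundle [f i]; [t] lists the agents
    already placed, and what is left over is always the total of those in [s]. A branch with no bad
    pair would end in [false], so a successful search must meet one on this branch. *)
Lemma searchP bad f s t :
  uniq (s ++ t) -> search bad s [seq (j, f j) | j <- t] (total f s) ->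
  exists i j, [/\ i \in s ++ t, j \in s ++ t, i != j & bad (i, f i) (j, f j)].
Proof.
elim: s t => [//|i s IHs] t uniq_st /allP/(_ (f i)).
(* The actual bundle is among the candidates, also for the last agent, whose only candidate is the
   whole remainder [f i] plus zero. *)
have -> : f i \in (if s is [::] then [:: total f (i :: s)]
                   else below (total f (i :: s))).
  case: s {IHs uniq_st} => [|j s]; last first.
    by rewrite mem_below; apply/forallP => k; rewrite component_add leq_addr.
  rewrite inE; apply/eqP/countsP => k; rewrite component_add.
  by case: k => [[|[|[|//]]] ?]; rewrite /= addn0.
move=> /(_ isT); rewrite /= add_countsK.
case: ifP => [/hasP[_ /mapP[j jt ->] bad_ij] _ | _ found].
  exists i, j; rewrite !inE eqxx !mem_cat jt !orbT; split=> //.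
  by apply: contraTneq uniq_st => ->; rewrite /= mem_cat jt orbT.
have eq_perm : perm_eq (s ++ i :: t) (i :: s ++ t).
  by rewrite perm_sym -cat1s perm_catCA.
have [|j [k [js ks neq_jk bad_jk]]] := IHs (i :: t) _ found.
  by rewrite (perm_uniq eq_perm).
by exists j, k; rewrite -!(perm_mem eq_perm).
Qed.

(** * The prices and the computation of the search *)

Definition weight (i : nat) : weights :=
  if (i < 3)%N then (157283, 100000, 20413)%num else (4, 1, 6)%num.

(* The test [0 <? m] excludes two empty bundles, where the ratio is 0 / 0. *)
Definition exceeds (i : nat) (u : counts) (m : N) : bool :=
  ((0 <? m) && (220413 * m <=? 200000 * price (weight i) u))%num.

(** Entries 0 to 4 cover every union of bundles, since each kind has four copies. The search then
    reads shares from a table instead of minimising at every node. *)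
Definition tabulate (f : counts -> N) : seq (seq (seq N)) :=
  [seq [seq [seq f (x, y, z) | z <- iota 0 5] | y <- iota 0 5] | x <- iota 0 5].

Definition lookup (table : seq (seq (seq N))) (v : counts) : N :=
  nth 0%num (nth [::] (nth [::] table v.1.1) v.1.2) v.2.

Lemma lookup_tabulate f v : v \in below (4, 4, 4)%N -> lookup (tabulate f) v = f v.
Proof.
case: v => [[x y] z]; rewrite mem_below => /forallP le_v.
have := le_v (@Ordinal 3 0 isT); have := le_v (@Ordinal 3 1 isT).
have := le_v (@Ordinal 3 2 isT); rewrite /component /= => lez ley lex.
rewrite /lookup /tabulate.
by rewrite !(nth_map 0%N) ?size_iota // !nth_iota.
Qed.

(** Both directions are tested because the search meets each unordered pair of agents only once. *)
Definition exceeding_pair (table0 table3 : seq (seq (seq N)))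
    (p q : nat * counts) : bool :=
  let shared i :=
    lookup (if (i < 3)%N then table0 else table3) (add_counts p.2 q.2) in
  exceeds p.1 p.2 (shared p.1) || exceeds q.1 q.2 (shared q.1).

(** The [let] binders let [vm_compute] build each table once, before the search. *)
Lemma search_five_agents :
  let table0 := tabulate (share (weight 0)) in
  let table3 := tabulate (share (weight 3)) in
  search (exceeding_pair table0 table3) (iota 0 5) [::] (4, 4, 4)%N.
Proof. by vm_compute. Qed.

(** * Sets of chores, each chore a pair (kind, copy), and their count vectors *)

Definition chore_kind : finType := ('I_3 * 'I_4)%type.

Definition kind_count (S : {set chore_kind}) (t : 'I_3) : nat :=
  #|[set g in S | g.1 == t]|.

Definition kind_counts (S : {set chore_kind}) : counts :=
  (kind_count S (@Ordinal 3 0 isT), kind_count S (@Ordinal 3 1 isT),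
   kind_count S (@Ordinal 3 2 isT)).

Lemma component_kind_counts S t : component (kind_counts S) t = kind_count S t.
Proof. by case: t => [[|[|[|//]]] ?]; congr (kind_count S); apply: val_inj. Qed.

Lemma kind_countE S t : kind_count S t = (\sum_(g in S) (g.1 == t))%N.
Proof. by rewrite /kind_count -sum1dep_card big_mkcondr. Qed.

Lemma kind_count_setT t : kind_count [set: chore_kind] t = 4%N.
Proof.
rewrite /kind_count (_ : [set g in _ | _] = setX [set t] [set: 'I_4]).
  by rewrite cardsX cards1 cardsT card_ord.
by apply/setP => g; rewrite !inE andbT.
Qed.

Lemma kind_countsU (A B : {set chore_kind}) : [disjoint A & B] ->
  kind_counts (A :|: B) = add_counts (kind_counts A) (kind_counts B).
Proof.
move=> dAB; apply/countsP => t.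
rewrite component_add !component_kind_counts !kind_countE -bigU //=.
by apply: eq_bigl => g; rewrite !inE.
Qed.

Lemma kind_counts_below (A B : {set chore_kind}) :
  A \subset B -> kind_counts A \in below (kind_counts B).
Proof.
move=> sAB; rewrite mem_below; apply/forallP => t.
rewrite !component_kind_counts; apply: subset_leq_card.
by apply/fintype.subsetP => g; rewrite !inE => /andP[/(fintype.subsetP sAB)-> ->].
Qed.

(** Pick any [component u t] chores of each kind [t] in [S] and collect them. Thus every split of
    counts comes from a split of sets. *)
Lemma subset_with_counts (S : {set chore_kind}) u :
  u \in below (kind_counts S) ->
  exists2 A : {set chore_kind}, A \subset S & kind_counts A = u.
Proof.
rewrite mem_below => /forallP le_u.
have /fin_all_exists[s s_P] : forall t : 'I_3, exists s : seq chore_kind,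
    [/\ uniq s, size s = component u t & {subset s <= [set g in S | g.1 == t]}].
  by move=> t; apply/card_geqP; rewrite -/(kind_count S t) -component_kind_counts.
have in_s t g : g \in s t -> (g \in S) /\ (g.1 = t).
  by have [_ _ sub] := s_P t => /sub; rewrite inE => /andP[-> /eqP].
exists [set g | g \in s g.1].
  by apply/fintype.subsetP => g; rewrite inE => /in_s[].
apply/countsP => t; rewrite component_kind_counts /kind_count.
have [uniq_s <- _] := s_P t; rewrite -(card_uniqP uniq_s); apply: eq_card => g.
rewrite !inE; apply/andP/idP => [[+ /eqP <-] //|gs].
by have [_ eq_t] := in_s _ _ gs; rewrite eq_t eqxx gs.
Qed.

(** * The instance, and a pair of ratio at least R in each allocation *)

Section Instance.
Variable R : realType.

Definition agent_cost (i : 'I_5) (S : {set chore_kind}) : R :=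
  \sum_(g in S) binR R (component (weight i) g.1).

Lemma agent_cost_additive i S :
  agent_cost i S = \sum_(g in S) agent_cost i [set g].
Proof. by apply: eq_bigr => g _; rewrite /agent_cost big_set1. Qed.

Lemma agent_cost_ge0 i S : 0 <= agent_cost i S.
Proof. by apply: sumr_ge0 => g _; exact: binR_ge0. Qed.

Definition three_two_instance : chore_instance R :=
  @ChoreInstance R 5 isT chore_kind agent_cost agent_cost_additive agent_cost_ge0.

Lemma agent_costE i S : agent_cost i S = binR R (price (weight i) (kind_counts S)).
Proof.
rewrite /agent_cost (partition_big (fun g : chore_kind => g.1) predT) //=.
rewrite (eq_bigr (fun t => binR R (component (weight i) t) * (kind_count S t)%:R)).
  rewrite !big_ord_recl big_ord0 addr0 addrA /price !binRD !binRM !binR_of_nat.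
  rewrite -!component_kind_counts.
  by congr (_ * _ + _ * _ + _ * _).
move=> t _; rewrite (eq_bigr (fun=> binR R (component (weight i) t))).
  rewrite sumr_const mulr_natr /kind_count; congr (_ *+ _).
  by apply: eq_card => g; rewrite !inE.
by move=> g /andP[_ /eqP ->].
Qed.

(** Splits transfer both ways: an optimal count split is realised by some [A] and [S :\: A], and an
    optimal bipartition of [S] yields the split given by the counts of its first part. *)
Lemma mms2E (i : 'I_(nagents three_two_instance)) (S : {set chore_kind}) :
  mms2 (I := three_two_instance) i S = binR R (share (weight i) (kind_counts S)).
Proof.
apply/le_anti/andP; split.
  have [u u_below ->] := share_attained (weight i) (kind_counts S).
  have [A sAS <-] := subset_with_counts _ _ u_below.
  have dAS : [disjoint A & S :\: A].
    by rewrite -setI_eq0 setIC setDE -setIA (setIC _ A) setICr setI0.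
  have eqS : A :|: S :\: A = S.
    by rewrite setUC setDE setUIl [~: A :|: A]setUC setUCr setIT; apply/setUidPl.
  rewrite /split_price.
  have -> : sub_counts (kind_counts S) (kind_counts A) = kind_counts (S :\: A).
    by rewrite -{1}eqS kind_countsU // add_countsK.
  rewrite binR_max -!agent_costE.
  apply: (@mms2_le R three_two_instance i S (A, S :\: A)).
  by rewrite /is_bipartition /= eqS eqxx.
have [P /andP[/eqP eqS dP] ->] := @mms2_attained R three_two_instance i S.
rewrite -[cost i P.1]/(agent_cost i P.1) -[cost i P.2]/(agent_cost i P.2).
rewrite !agent_costE -binR_max; apply: binR_le.
have -> : kind_counts P.2 = sub_counts (kind_counts S) (kind_counts P.1).
  by rewrite -eqS kind_countsU // add_countsK.
by apply: share_le; apply: kind_counts_below; rewrite -eqS subsetUl.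
Qed.

(** Clears the denominator, turning comparisons with the bound into integer ones. *)
Lemma pmms_bound_binR : pmms_bound R * binR R 200000 = binR R 220413.
Proof.
(* Only small factors remain when [binR] is unlocked, which keeps the unary numerals short. *)
have -> : binR R 220413 = 220 * 10 ^+ 3 + 413.
  by rewrite (_ : 220413 = 220 * (10 * (10 * 10)) + 413)%num // binRD !binRM exprS expr2 binR.unlock.
have -> : binR R 200000 = 2 * 10 ^+ 5.
  by rewrite (_ : 200000 = 2 * (10 * (10 * (10 * (10 * 10)))))%num // !binRM !exprS expr0 mulr1 binR.unlock.
by rewrite /pmms_bound divfK // mulf_neq0 ?expf_neq0 // pnatr_eq0.
Qed.

Lemma pmms_bound_gt1 : 1 < pmms_bound R.
Proof.
have b_gt0 : 0 < binR R 200000 by apply: binR_gt0.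
rewrite -(ltr_pM2r b_gt0) mul1r pmms_bound_binR.
rewrite -[220413%num]/(20413 + 200000)%num binRD ltrDr.
by apply: binR_gt0.
Qed.

Lemma exceedsP (i : 'I_5) (A S : {set chore_kind}) :
  exceeds i (kind_counts A) (share (weight i) (kind_counts S)) ->
  0 < mms2 (I := three_two_instance) i S /\
  pmms_bound R * mms2 (I := three_two_instance) i S <= agent_cost i A.
Proof.
rewrite mms2E => /andP[/N.ltb_lt share_gt0 /N.leb_le le_price]; split.
  by apply: binR_gt0; apply: (proj2 (N.neq_0_lt_0 _)).
have b_gt0 : 0 < binR R 200000 by apply: binR_gt0.
rewrite -(ler_pM2l b_gt0) mulrA (mulrC (binR R _)) pmms_bound_binR.
rewrite agent_costE -(binRM _ 220413) -(binRM _ 200000).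
exact: (binR_le _ _ _ le_price).
Qed.

Lemma component_total f s t :
  component (total f s) t = (\sum_(k <- s) component (f k) t)%N.
Proof.
elim: s => [|k s IHs]; first by rewrite big_nil; case: t => [[|[|[|//]]] ?].
by rewrite big_cons /= component_add IHs.
Qed.

(** The bundles partition the chores, so their counts add up to [(4, 4, 4)] and the completed search
    applies to them. *)
Lemma allocation_pair (X : assignment three_two_instance) : is_allocation X ->
  exists i j : 'I_(nagents three_two_instance), [/\ i != j, 0 < mms2 i (X i :|: X j) &
    pmms_bound R * mms2 i (X i :|: X j) <= cost i (X i)].
Proof.
case/andP=> /forallP disjX /eqP coverX.
have {}disjX (i j : 'I_(nagents three_two_instance)) : i != j -> [disjoint X i & X j].
  by move: (disjX i) => /forallP/(_ j)/implyP; apply.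
pose f k := kind_counts (X (inord k : 'I_5)).
have totalX : total f (iota 0 5) = (4, 4, 4)%N.
  apply/countsP => t; rewrite component_total -/(index_iota 0 5) big_mkord.
  rewrite (eq_bigr (fun i => \sum_(g in X i) (g.1 == t))%N).
    rewrite -partition_disjoint_bigcup // coverX -kind_countE kind_count_setT.
    by case: t => [[|[|[|//]]] ?].
  by move=> i _; rewrite /f inord_val component_kind_counts kind_countE.
have [//||i [j []]] := searchP (exceeding_pair (tabulate (share (weight 0)))
  (tabulate (share (weight 3)))) f (iota 0 5) [::].
  by rewrite totalX; exact: search_five_agents.
rewrite cats0 !mem_iota /= add0n => i5 j5 neq_ij.
(* The search indexes agents by naturals; writing them as values of ordinals lets [inord_val]
   recover the bundles. *)
have [i' def_i] : exists i' : 'I_5, i = i' by exists (Ordinal i5).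
have [j' def_j] : exists j' : 'I_5, j = j' by exists (Ordinal j5).
move: neq_ij; rewrite {}def_i {}def_j /f !inord_val => neq_ij.
rewrite /exceeding_pair /= -kind_countsU ?disjX //.
set S := X i' :|: X j'.
have S_below : kind_counts S \in below (4, 4, 4)%N.
  rewrite mem_below; apply/forallP => t; apply: leq_trans (_ : (4 <= _)%N).
    rewrite component_kind_counts -(kind_count_setT t) -!component_kind_counts.
    by have := kind_counts_below _ _ (finset.subsetT S); rewrite mem_below => /forallP.
  by case: t => [[|[|[|//]]] ?].
have sharedE (k : nat) : lookup (if (k < 3)%N then tabulate (share (weight 0))
    else tabulate (share (weight 3))) (kind_counts S) = share (weight k) (kind_counts S).
  by rewrite /weight; case: ifP => _; rewrite lookup_tabulate.
rewrite !sharedE => /orP[] /exceedsP[gt0 le_cost]; first by exists i', j'.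
by exists j', i'; rewrite eq_sym (setUC (X j')).
Qed.

End Instance.

(** * An allocation whose factor is at most R *)

Definition owner (g : chore_kind) : nat :=
  nth 5 (nth [::] [:: [:: 3; 3; 4; 4]; [:: 0; 0; 1; 2]; [:: 0; 1; 1; 2]] g.1) g.2.

Definition owner_counts (i : nat) : counts :=
  nth (0, 0, 0)%N
    [:: (0, 2, 1)%N; (0, 1, 2)%N; (0, 1, 1)%N; (2, 0, 0)%N; (2, 0, 0)%N] i.

(** The bound is tight for agent 0, who pays 220413: the union with agent 1 or 2 holds three chores
    of price 100000, two of which fall on one side of any split, so the share is 200000. *)
Lemma owner_counts_fair :
  all (fun i => all (fun j => (200000 * price (weight i) (owner_counts i) <=?
      220413 * share (weight i) (add_counts (owner_counts i) (owner_counts j)))%num)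
    (iota 0 5)) (iota 0 5).
Proof. by vm_compute. Qed.

Lemma kind_counts_owner (i : 'I_5) :
  kind_counts [set g | owner g == i] = owner_counts i.
Proof.
have count_row t : kind_count [set g | owner g == i] t =
    (\sum_(k < 4) (owner (t, k) == i))%N.
  rewrite /kind_count (_ : [set g in _ | _] = pair t @: [set k | owner (t, k) == i]).
    by rewrite card_imset => [|k l []//]; rewrite -sum1dep_card big_mkcond.
  apply/setP=> -[t' k]; rewrite !inE /=; apply/andP/imsetP => [[own /eqP <-]|].
    by exists k; rewrite ?inE.
  by case=> l; rewrite inE => own [-> ->].
apply/countsP => t; rewrite component_kind_counts count_row !big_ord_recl big_ord0.
by case: t i {count_row} => [[|[|[|//]]] ?] [[|[|[|[|[|//]]]]] ?].
Qed.

Definition owner_allocation (R : realType) : assignment (three_two_instance R) :=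
  [ffun i : 'I_5 => [set g : chore_kind | owner g == i]].

Lemma owner_lt5 g : (owner g < 5)%N.
Proof. by case: g => [[[|[|[|//]]] ?] [[|[|[|[|//]]]] ?]]. Qed.

Lemma owner_allocationP (R : realType) : is_allocation (owner_allocation R).
Proof.
apply/andP; split.
  apply/forallP => i; apply/forallP => j; apply/implyP; apply: contraR.
  rewrite !ffunE => /pred0Pn[g /=]; rewrite !inE => /andP[/eqP own_i /eqP own_j].
  by apply/eqP/val_inj; apply: etrans (esym own_i) own_j.
apply/eqP/setP => g; rewrite inE; apply/bigcupP.
by exists (Ordinal (owner_lt5 g)); rewrite // ffunE inE.
Qed.

Lemma owner_allocation_factor (R : realType) :
  pmms_factor (owner_allocation R) <= pmms_bound R.
Proof.
apply: bigmax_le => [|[i j] /= /andP[neq_ij mms_gt0]].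
  by apply: ltW; apply: lt_trans ltr01 (pmms_bound_gt1 R).
rewrite ler_pdivrMr //.
have dX : [disjoint owner_allocation R i & owner_allocation R j].
  have /andP[/forallP/(_ i)/forallP/(_ j)/implyP disjX _] := owner_allocationP R.
  exact: disjX.
have b_gt0 : 0 < binR R 200000 by apply: binR_gt0.
have countsE k : kind_counts (owner_allocation R k) = owner_counts k.
  by rewrite ffunE kind_counts_owner.
rewrite -(ler_pM2l b_gt0) mulrA (mulrC _ (pmms_bound R)) pmms_bound_binR mms2E.
rewrite agent_costE -!binRM kind_countsU // !countsE.
apply/binR_le/N.leb_le.
have /allP/(_ i) := owner_counts_fair; rewrite mem_iota ltn_ord => /(_ isT).
by move=> /allP/(_ j); rewrite mem_iota ltn_ord; apply.
Qed.

(** * The optimal factor and its consequences *)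

Lemma pmms_factor_ge (R : realType) (X : assignment (three_two_instance R)) :
  is_allocation X -> pmms_bound R <= pmms_factor X.
Proof.
move=> /allocation_pair[i [j [neq_ij mms_gt0 le_cost]]].
apply: le_trans (_ : cost i (X i) / mms2 i (X i :|: X j) <= _).
  by rewrite ler_pdivlMr.
by apply: (le_bigmax_cond _ (j := (i, j))
  (fun p => cost p.1 (X p.1) / mms2 p.1 (X p.1 :|: X p.2))); rewrite /= neq_ij.
Qed.

Lemma optimal_three_two (R : realType) :
  optimal_pmms_factor (three_two_instance R) = pmms_bound R.
Proof.
apply/le_anti/andP; split.
  exact: le_trans (optimal_pmms_le (owner_allocationP R)) (owner_allocation_factor R).
have [X alloc_X ->] := optimal_pmms_attained (three_two_instance R).
exact: pmms_factor_ge.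
Qed.

Theorem theorem21 (R : realType) :
  (exists I : chore_instance R,
     nagents I = 5%N /\
     #|chore I| = 12%N /\
     (forall (i : 'I_(nagents I)) (g : chore I), 0 < cost i [set g]) /\
     (~ exists X : assignment I, is_allocation X /\ is_exact_PMMS X) /\
     optimal_pmms_factor I = pmms_bound R) /\
  ((pmms_bound R)%:E <= pmms_sup R)%E /\
  1 < pmms_bound R.
Proof.
split; last first.
  split; last exact: pmms_bound_gt1.
  apply: ereal_sup_ubound; exists (three_two_instance R).
  by rewrite optimal_three_two.
exists (three_two_instance R); split=> //; split; first by rewrite card_prod !card_ord.
split=> [i g|].
  rewrite -[cost i _]/(agent_cost R i _) /agent_cost big_set1; apply: binR_gt0.
  by case: i g => [[|[|[|[|[|//]]]]] ?] [[[|[|[|//]]] ?] ?].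
split; last exact: optimal_three_two.
case=> X [alloc_X exact_X].
have [i [j [neq_ij mms_gt0 le_cost]]] := allocation_pair _ _ alloc_X.
have := le_trans le_cost (exact_X i j neq_ij).
(* Exactness would give R times mu at most mu with mu positive, against R > 1. *)
by rewrite ler_pM2r // leNgt pmms_bound_gt1.
Qed.
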